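(* Let $(A,\cdot,\{~,~,~\},\{\!\{~,~,~\}\!\})$ be an associative-Yamaguti algebra, $(M,\cdot,\{~,~,~\},\{\!\{~,~,~\}\!\})$ a representation of it, and $R:M\to A$ a relative Rota-Baxter operator. For any $u,v,w\in M$ define $$u\prec v:=u\cdot R(v),\qquad u\succ v:=R(u)\cdot v,$$ $$\{u,v,w\}_{[1]}:=\{u,R(v),R(w)\},\quad \{u,v,w\}_{[2]}:=\{R(u),v,R(w)\},\quad \{u,v,w\}_{[3]}:=\{R(u),R(v),w\},$$ $$\{\!\{u,v,w\}\!\}_{[1]}:=\{\!\{u,R(v),R(w)\}\!\},\quad \{\!\{u,v,w\}\!\}_{[2]}:=\{\!\{R(u),v,R(w)\}\!\},\quad \{\!\{u,v,w\}\!\}_{[3]}:=\{\!\{R(u),R(v),w\}\!\}.$$ Then $(M,\prec,\succ,\{~,~,~\}_{[1]},\{~,~,~\}_{[2]},\{~,~,~\}_{[3]},\{\!\{~,~,~\}\!\}_{[1]},\{\!\{~,~,~\}\!\}_{[2]},\{\!\{~,~,~\}\!\}_{[3]})$ is a dendriform-Yamaguti algebra.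
   Context: All vector spaces, linear maps and tensor products are over a field $\mathbf{k}$ of characteristic $0$. An associative-Yamaguti algebra is a quadruple $(A,\cdot,\{~,~,~\},\{\!\{~,~,~\}\!\})$ consisting of a vector space $A$ with linear operations $\cdot:A\otimes A\to A$ and $\{~,~,~\},\{\!\{~,~,~\}\!\}:A\otimes A\otimes A\to A$ such that for all $a,b,c,d,e\in A$: (AY1) $(a\cdot b)\cdot c-a\cdot(b\cdot c)+\{a,b,c\}-\{\!\{a,b,c\}\!\}=0$; (AY2) $\{a\cdot b,c,d\}=\{a,b\cdot c,d\}$; (AY3) $\{a,b,c\cdot d\}=\{a,b,c\}\cdot d$; (AY4) $\{\!\{a\cdot b,c,d\}\!\}=a\cdot\{\!\{b,c,d\}\!\}$; (AY5) $\{\!\{a,b\cdot c,d\}\!\}=\{\!\{a,b,c\cdot d\}\!\}$; (AY6) $a\cdot\{b,c,d\}=\{\!\{a,b,c\}\!\}\cdot d$; (AY7) $\{\{a,b,c\},d,e\}=\{a,\{\!\{b,c,d\}\!\},e\}=\{a,b,\{c,d,e\}\}$; (AY8) $\{a,\{b,c,d\},e\}=\{\{\!\{a,b,c\}\!\},d,e\}$; (AY9) $\{\!\{\{\!\{a,b,c\}\!\},d,e\}\!\}=\{\!\{a,\{b,c,d\},e\}\!\}=\{\!\{a,b,\{\!\{c,d,e\}\!\}\}\!\}$; (AY10) $\{\!\{a,\{\!\{b,c,d\}\!\},e\}\!\}=\{\!\{a,b,\{c,d,e\}\}\!\}$; (AY11) $\{a,b,\{\!\{c,d,e\}\!\}\}=\{\!\{\{a,b,c\},d,e\}\!\}$.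 A representation of $A$ is a vector space $M$ with linear maps (denoted by the same symbols) $\cdot:A\otimes M\to M$, $\cdot:M\otimes A\to M$, and $\{~,~,~\}$ and $\{\!\{~,~,~\}\!\}$ each defined as linear maps $A\otimes A\otimes M\to M$, $A\otimes M\otimes A\to M$, $M\otimes A\otimes A\to M$, such that the identities (AY1)-(AY11) hold whenever exactly one of the variables is in $M$ and the others are in $A$. A relative Rota-Baxter operator is a linear map $R:M\to A$ such that for all $u,v,w\in M$: $R(u)\cdot R(v)=R(R(u)\cdot v+u\cdot R(v))$; $\{R(u),R(v),R(w)\}=R(\{R(u),R(v),w\}+\{R(u),v,R(w)\}+\{u,R(v),R(w)\})$; $\{\!\{R(u),R(v),R(w)\}\!\}=R(\{\!\{R(u),R(v),w\}\!\}+\{\!\{R(u),v,R(w)\}\!\}+\{\!\{u,R(v),R(w)\}\!\})$. A dendriform-Yamaguti algebra is a vector space $D$ with linear operations $\prec,\succ:D\otimes D\to D$ and $\{~,~,~\}_{[i]},\{\!\{~,~,~\}\!\}_{[i]}:D\otimes D\otimes D\to D$ ($i=1,2,3$) such that, writing $a*b:=a\prec b+a\succ b$, $\{a,b,c\}_{\mathrm{Tot}}:=\sum_{i=1}^3\{a,b,c\}_{[i]}$ and $\{\!\{a,b,c\}\!\}_{\mathrm{Tot}}:=\sum_{i=1}^3\{\!\{a,b,c\}\!\}_{[i]}$, the following hold for all $a,b,c,d,e\in D$: (DY1) $(a\prec b)\prec c-a\prec(b*c)+\{a,b,c\}_{[1]}-\{\!\{a,b,c\}\!\}_{[1]}=0$;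 $(a\succ b)\prec c-a\succ(b\prec c)+\{a,b,c\}_{[2]}-\{\!\{a,b,c\}\!\}_{[2]}=0$; $(a*b)\succ c-a\succ(b\succ c)+\{a,b,c\}_{[3]}-\{\!\{a,b,c\}\!\}_{[3]}=0$. (DY2) $\{a\prec b,c,d\}_{[1]}=\{a,b*c,d\}_{[1]}$; $\{a\succ b,c,d\}_{[1]}=\{a,b\prec c,d\}_{[2]}$; $\{a*b,c,d\}_{[2]}=\{a,b\succ c,d\}_{[2]}$; $\{a*b,c,d\}_{[3]}=\{a,b*c,d\}_{[3]}$. (DY3) $\{a,b,c*d\}_{[1]}=\{a,b,c\}_{[1]}\prec d$; $\{a,b,c*d\}_{[2]}=\{a,b,c\}_{[2]}\prec d$; $\{a,b,c\prec d\}_{[3]}=\{a,b,c\}_{[3]}\prec d$; $\{a,b,c\succ d\}_{[3]}=\{a,b,c\}_{\mathrm{Tot}}\succ d$. (DY4) $\{\!\{a\prec b,c,d\}\!\}_{[1]}=a\prec\{\!\{b,c,d\}\!\}_{\mathrm{Tot}}$; $\{\!\{a\succ b,c,d\}\!\}_{[1]}=a\succ\{\!\{b,c,d\}\!\}_{[1]}$; $\{\!\{a*b,c,d\}\!\}_{[2]}=a\succ\{\!\{b,c,d\}\!\}_{[2]}$; $\{\!\{a*b,c,d\}\!\}_{[3]}=a\succ\{\!\{b,c,d\}\!\}_{[3]}$. (DY5) $\{\!\{a,b*c,d\}\!\}_{[1]}=\{\!\{a,b,c*d\}\!\}_{[1]}$; $\{\!\{a,b\prec c,d\}\!\}_{[2]}=\{\!\{a,b,c*d\}\!\}_{[2]}$;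 $\{\!\{a,b\succ c,d\}\!\}_{[2]}=\{\!\{a,b,c\prec d\}\!\}_{[3]}$; $\{\!\{a,b*c,d\}\!\}_{[3]}=\{\!\{a,b,c\succ d\}\!\}_{[3]}$. (DY6) $a\prec\{b,c,d\}_{\mathrm{Tot}}=\{\!\{a,b,c\}\!\}_{[1]}\prec d$; $a\succ\{b,c,d\}_{[1]}=\{\!\{a,b,c\}\!\}_{[2]}\prec d$; $a\succ\{b,c,d\}_{[2]}=\{\!\{a,b,c\}\!\}_{[3]}\prec d$; $a\succ\{b,c,d\}_{[3]}=\{\!\{a,b,c\}\!\}_{\mathrm{Tot}}\succ d$. (DY7) $\{\{a,b,c\}_{[1]},d,e\}_{[1]}=\{a,\{\!\{b,c,d\}\!\}_{\mathrm{Tot}},e\}_{[1]}=\{a,b,\{c,d,e\}_{\mathrm{Tot}}\}_{[1]}$; $\{\{a,b,c\}_{[2]},d,e\}_{[1]}=\{a,\{\!\{b,c,d\}\!\}_{[1]},e\}_{[2]}=\{a,b,\{c,d,e\}_{\mathrm{Tot}}\}_{[2]}$; $\{\{a,b,c\}_{[3]},d,e\}_{[1]}=\{a,\{\!\{b,c,d\}\!\}_{[2]},e\}_{[2]}=\{a,b,\{c,d,e\}_{[1]}\}_{[3]}$; $\{\{a,b,c\}_{\mathrm{Tot}},d,e\}_{[2]}=\{a,\{\!\{b,c,d\}\!\}_{[3]},e\}_{[2]}=\{a,b,\{c,d,e\}_{[2]}\}_{[3]}$; $\{\{a,b,c\}_{\mathrm{Tot}},d,e\}_{[3]}=\{a,\{\!\{b,c,d\}\!\}_{\mathrm{Tot}},e\}_{[3]}=\{a,b,\{c,d,e\}_{[3]}\}_{[3]}$.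 (DY8) $\{a,\{b,c,d\}_{\mathrm{Tot}},e\}_{[1]}=\{\{\!\{a,b,c\}\!\}_{[1]},d,e\}_{[1]}$; $\{a,\{b,c,d\}_{[1]},e\}_{[2]}=\{\{\!\{a,b,c\}\!\}_{[2]},d,e\}_{[1]}$; $\{a,\{b,c,d\}_{[2]},e\}_{[2]}=\{\{\!\{a,b,c\}\!\}_{[3]},d,e\}_{[1]}$; $\{a,\{b,c,d\}_{[3]},e\}_{[2]}=\{\{\!\{a,b,c\}\!\}_{\mathrm{Tot}},d,e\}_{[2]}$; $\{a,\{b,c,d\}_{\mathrm{Tot}},e\}_{[3]}=\{\{\!\{a,b,c\}\!\}_{\mathrm{Tot}},d,e\}_{[3]}$. (DY9) $\{\!\{\{\!\{a,b,c\}\!\}_{[1]},d,e\}\!\}_{[1]}=\{\!\{a,\{b,c,d\}_{\mathrm{Tot}},e\}\!\}_{[1]}=\{\!\{a,b,\{\!\{c,d,e\}\!\}_{\mathrm{Tot}}\}\!\}_{[1]}$; $\{\!\{\{\!\{a,b,c\}\!\}_{[2]},d,e\}\!\}_{[1]}=\{\!\{a,\{b,c,d\}_{[1]},e\}\!\}_{[2]}=\{\!\{a,b,\{\!\{c,d,e\}\!\}_{\mathrm{Tot}}\}\!\}_{[2]}$; $\{\!\{\{\!\{a,b,c\}\!\}_{[3]},d,e\}\!\}_{[1]}=\{\!\{a,\{b,c,d\}_{[2]},e\}\!\}_{[2]}=\{\!\{a,b,\{\!\{c,d,e\}\!\}_{[1]}\}\!\}_{[3]}$; $\{\!\{\{\!\{a,b,c\}\!\}_{\mathrm{Tot}},d,e\}\!\}_{[2]}=\{\!\{a,\{b,c,d\}_{[3]},e\}\!\}_{[2]}=\{\!\{a,b,\{\!\{c,d,e\}\!\}_{[2]}\}\!\}_{[3]}$;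 $\{\!\{\{\!\{a,b,c\}\!\}_{\mathrm{Tot}},d,e\}\!\}_{[3]}=\{\!\{a,\{b,c,d\}_{\mathrm{Tot}},e\}\!\}_{[3]}=\{\!\{a,b,\{\!\{c,d,e\}\!\}_{[3]}\}\!\}_{[3]}$. (DY10) $\{\!\{a,\{\!\{b,c,d\}\!\}_{\mathrm{Tot}},e\}\!\}_{[1]}=\{\!\{a,b,\{c,d,e\}_{\mathrm{Tot}}\}\!\}_{[1]}$; $\{\!\{a,\{\!\{b,c,d\}\!\}_{[1]},e\}\!\}_{[2]}=\{\!\{a,b,\{c,d,e\}_{\mathrm{Tot}}\}\!\}_{[2]}$; $\{\!\{a,\{\!\{b,c,d\}\!\}_{[2]},e\}\!\}_{[2]}=\{\!\{a,b,\{c,d,e\}_{[1]}\}\!\}_{[3]}$; $\{\!\{a,\{\!\{b,c,d\}\!\}_{[3]},e\}\!\}_{[2]}=\{\!\{a,b,\{c,d,e\}_{[2]}\}\!\}_{[3]}$; $\{\!\{a,\{\!\{b,c,d\}\!\}_{\mathrm{Tot}},e\}\!\}_{[3]}=\{\!\{a,b,\{c,d,e\}_{[3]}\}\!\}_{[3]}$. (DY11) $\{a,b,\{\!\{c,d,e\}\!\}_{\mathrm{Tot}}\}_{[1]}=\{\!\{\{a,b,c\}_{[1]},d,e\}\!\}_{[1]}$; $\{a,b,\{\!\{c,d,e\}\!\}_{\mathrm{Tot}}\}_{[2]}=\{\!\{\{a,b,c\}_{[2]},d,e\}\!\}_{[1]}$; $\{a,b,\{\!\{c,d,e\}\!\}_{[1]}\}_{[3]}=\{\!\{\{a,b,c\}_{[3]},d,e\}\!\}_{[1]}$;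 $\{a,b,\{\!\{c,d,e\}\!\}_{[2]}\}_{[3]}=\{\!\{\{a,b,c\}_{\mathrm{Tot}},d,e\}\!\}_{[2]}$; $\{a,b,\{\!\{c,d,e\}\!\}_{[3]}\}_{[3]}=\{\!\{\{a,b,c\}_{\mathrm{Tot}},d,e\}\!\}_{[3]}$. *)

(* Defs.v *)
From mathcomp Require Import all_boot all_order all_algebra.

Set Implicit Arguments.
Unset Strict Implicit.
Unset Printing Implicit Defensive.

Import GRing.Theory.
Local Open Scope ring_scope.

(* Vector spaces over k are arbitrary (possibly infinite-dimensional)
   [lmodType k].  A linear map out of a tensor product is represented by the
   corresponding multilinear map. *)

Definition bilinear_map (k : fieldType) (U V W : lmodType k)
    (f : U -> V -> W) : Prop :=
  bilinear_for *:%R *:%R f.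

Definition trilinear_map (k : fieldType) (U V W X : lmodType k)
    (f : U -> V -> W -> X) : Prop :=
  [/\ forall v w, linear (fun u => f u v w),
      forall u w, linear (fun v => f u v w) &
      forall u v, linear (fun w => f u v w)].

(* [br a b c] stands for the single brace {a, b, c} and [dbr a b c] for the
   double brace {{a, b, c}}. *)

Record is_assoc_Yamaguti (k : fieldType) (A : lmodType k)
    (mul : A -> A -> A) (br dbr : A -> A -> A -> A) : Prop := {
  AY_mul : bilinear_map mul;
  AY_br : trilinear_map br;
  AY_dbr : trilinear_map dbr;
  AY1 : forall a b c,
    mul (mul a b) c - mul a (mul b c) + br a b c - dbr a b c = 0;
  AY2 : forall a b c d, br (mul a b) c d = br a (mul b c) d;
  AY3 : forall a b c d, br a b (mul c d) = mul (br a b c) d;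
  AY4 : forall a b c d, dbr (mul a b) c d = mul a (dbr b c d);
  AY5 : forall a b c d, dbr a (mul b c) d = dbr a b (mul c d);
  AY6 : forall a b c d, mul a (br b c d) = mul (dbr a b c) d;
  AY7 : forall a b c d e,
    br (br a b c) d e = br a (dbr b c d) e /\
    br a (dbr b c d) e = br a b (br c d e);
  AY8 : forall a b c d e, br a (br b c d) e = br (dbr a b c) d e;
  AY9 : forall a b c d e,
    dbr (dbr a b c) d e = dbr a (br b c d) e /\
    dbr a (br b c d) e = dbr a b (dbr c d e);
  AY10 : forall a b c d e, dbr a (dbr b c d) e = dbr a b (br c d e);
  AY11 : forall a b c d e, br a b (dbr c d e) = dbr (br a b c) d e
}.

(* The index carried by a structure map of a representation is the position of
   its argument in M (so [mul1 : M -> A -> M] is the right action, [mul2] the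
   left one).  Field [repAYn_i] is identity (AYn) with its i-th variable, named
   [u], ranging over M and all its other variables ranging over A. *)

Record is_representation (k : fieldType) (A : lmodType k)
    (mul : A -> A -> A) (br dbr : A -> A -> A -> A)
    (M : lmodType k)
    (mul1 : M -> A -> M) (mul2 : A -> M -> M)
    (br1 : M -> A -> A -> M) (br2 : A -> M -> A -> M) (br3 : A -> A -> M -> M)
    (dbr1 : M -> A -> A -> M) (dbr2 : A -> M -> A -> M)
    (dbr3 : A -> A -> M -> M) : Prop := {
  rep_mul1 : bilinear_map mul1;
  rep_mul2 : bilinear_map mul2;
  rep_br1 : trilinear_map br1;
  rep_br2 : trilinear_map br2;
  rep_br3 : trilinear_map br3;
  rep_dbr1 : trilinear_map dbr1;
  rep_dbr2 : trilinear_map dbr2;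
  rep_dbr3 : trilinear_map dbr3;

  repAY1_1 : forall u b c,
    mul1 (mul1 u b) c - mul1 u (mul b c) + br1 u b c - dbr1 u b c = 0;
  repAY1_2 : forall a u c,
    mul1 (mul2 a u) c - mul2 a (mul1 u c) + br2 a u c - dbr2 a u c = 0;
  repAY1_3 : forall a b u,
    mul2 (mul a b) u - mul2 a (mul2 b u) + br3 a b u - dbr3 a b u = 0;

  repAY2_1 : forall u b c d, br1 (mul1 u b) c d = br1 u (mul b c) d;
  repAY2_2 : forall a u c d, br1 (mul2 a u) c d = br2 a (mul1 u c) d;
  repAY2_3 : forall a b u d, br2 (mul a b) u d = br2 a (mul2 b u) d;
  repAY2_4 : forall a b c u, br3 (mul a b) c u = br3 a (mul b c) u;

  repAY3_1 : forall u b c d, br1 u b (mul c d) = mul1 (br1 u b c) d;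
  repAY3_2 : forall a u c d, br2 a u (mul c d) = mul1 (br2 a u c) d;
  repAY3_3 : forall a b u d, br3 a b (mul1 u d) = mul1 (br3 a b u) d;
  repAY3_4 : forall a b c u, br3 a b (mul2 c u) = mul2 (br a b c) u;

  repAY4_1 : forall u b c d, dbr1 (mul1 u b) c d = mul1 u (dbr b c d);
  repAY4_2 : forall a u c d, dbr1 (mul2 a u) c d = mul2 a (dbr1 u c d);
  repAY4_3 : forall a b u d, dbr2 (mul a b) u d = mul2 a (dbr2 b u d);
  repAY4_4 : forall a b c u, dbr3 (mul a b) c u = mul2 a (dbr3 b c u);

  repAY5_1 : forall u b c d, dbr1 u (mul b c) d = dbr1 u b (mul c d);
  repAY5_2 : forall a u c d, dbr2 a (mul1 u c) d = dbr2 a u (mul c d);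
  repAY5_3 : forall a b u d, dbr2 a (mul2 b u) d = dbr3 a b (mul1 u d);
  repAY5_4 : forall a b c u, dbr3 a (mul b c) u = dbr3 a b (mul2 c u);

  repAY6_1 : forall u b c d, mul1 u (br b c d) = mul1 (dbr1 u b c) d;
  repAY6_2 : forall a u c d, mul2 a (br1 u c d) = mul1 (dbr2 a u c) d;
  repAY6_3 : forall a b u d, mul2 a (br2 b u d) = mul1 (dbr3 a b u) d;
  repAY6_4 : forall a b c u, mul2 a (br3 b c u) = mul2 (dbr a b c) u;

  repAY7_1 : forall u b c d e,
    br1 (br1 u b c) d e = br1 u (dbr b c d) e /\
    br1 u (dbr b c d) e = br1 u b (br c d e);
  repAY7_2 : forall a u c d e,
    br1 (br2 a u c) d e = br2 a (dbr1 u c d) e /\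
    br2 a (dbr1 u c d) e = br2 a u (br c d e);
  repAY7_3 : forall a b u d e,
    br1 (br3 a b u) d e = br2 a (dbr2 b u d) e /\
    br2 a (dbr2 b u d) e = br3 a b (br1 u d e);
  repAY7_4 : forall a b c u e,
    br2 (br a b c) u e = br2 a (dbr3 b c u) e /\
    br2 a (dbr3 b c u) e = br3 a b (br2 c u e);
  repAY7_5 : forall a b c d u,
    br3 (br a b c) d u = br3 a (dbr b c d) u /\
    br3 a (dbr b c d) u = br3 a b (br3 c d u);

  repAY8_1 : forall u b c d e, br1 u (br b c d) e = br1 (dbr1 u b c) d e;
  repAY8_2 : forall a u c d e, br2 a (br1 u c d) e = br1 (dbr2 a u c) d e;
  repAY8_3 : forall a b u d e, br2 a (br2 b u d) e = br1 (dbr3 a b u) d e;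
  repAY8_4 : forall a b c u e, br2 a (br3 b c u) e = br2 (dbr a b c) u e;
  repAY8_5 : forall a b c d u, br3 a (br b c d) u = br3 (dbr a b c) d u;

  repAY9_1 : forall u b c d e,
    dbr1 (dbr1 u b c) d e = dbr1 u (br b c d) e /\
    dbr1 u (br b c d) e = dbr1 u b (dbr c d e);
  repAY9_2 : forall a u c d e,
    dbr1 (dbr2 a u c) d e = dbr2 a (br1 u c d) e /\
    dbr2 a (br1 u c d) e = dbr2 a u (dbr c d e);
  repAY9_3 : forall a b u d e,
    dbr1 (dbr3 a b u) d e = dbr2 a (br2 b u d) e /\
    dbr2 a (br2 b u d) e = dbr3 a b (dbr1 u d e);
  repAY9_4 : forall a b c u e,
    dbr2 (dbr a b c) u e = dbr2 a (br3 b c u) e /\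
    dbr2 a (br3 b c u) e = dbr3 a b (dbr2 c u e);
  repAY9_5 : forall a b c d u,
    dbr3 (dbr a b c) d u = dbr3 a (br b c d) u /\
    dbr3 a (br b c d) u = dbr3 a b (dbr3 c d u);

  repAY10_1 : forall u b c d e, dbr1 u (dbr b c d) e = dbr1 u b (br c d e);
  repAY10_2 : forall a u c d e, dbr2 a (dbr1 u c d) e = dbr2 a u (br c d e);
  repAY10_3 : forall a b u d e, dbr2 a (dbr2 b u d) e = dbr3 a b (br1 u d e);
  repAY10_4 : forall a b c u e, dbr2 a (dbr3 b c u) e = dbr3 a b (br2 c u e);
  repAY10_5 : forall a b c d u, dbr3 a (dbr b c d) u = dbr3 a b (br3 c d u);

  repAY11_1 : forall u b c d e, br1 u b (dbr c d e) = dbr1 (br1 u b c) d e;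
  repAY11_2 : forall a u c d e, br2 a u (dbr c d e) = dbr1 (br2 a u c) d e;
  repAY11_3 : forall a b u d e, br3 a b (dbr1 u d e) = dbr1 (br3 a b u) d e;
  repAY11_4 : forall a b c u e, br3 a b (dbr2 c u e) = dbr2 (br a b c) u e;
  repAY11_5 : forall a b c d u, br3 a b (dbr3 c d u) = dbr3 (br a b c) d u
}.

Record is_relative_Rota_Baxter (k : fieldType) (A : lmodType k)
    (mul : A -> A -> A) (br dbr : A -> A -> A -> A)
    (M : lmodType k)
    (mul1 : M -> A -> M) (mul2 : A -> M -> M)
    (br1 : M -> A -> A -> M) (br2 : A -> M -> A -> M) (br3 : A -> A -> M -> M)
    (dbr1 : M -> A -> A -> M) (dbr2 : A -> M -> A -> M)
    (dbr3 : A -> A -> M -> M)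
    (R : {linear M -> A}) : Prop := {
  RB_mul : forall u v, mul (R u) (R v) = R (mul2 (R u) v + mul1 u (R v));
  RB_br : forall u v w,
    br (R u) (R v) (R w) =
    R (br3 (R u) (R v) w + br2 (R u) v (R w) + br1 u (R v) (R w));
  RB_dbr : forall u v w,
    dbr (R u) (R v) (R w) =
    R (dbr3 (R u) (R v) w + dbr2 (R u) v (R w) + dbr1 u (R v) (R w))
}.

Definition total2 (k : fieldType) (D : lmodType k) (f g : D -> D -> D)
    (a b : D) : D :=
  f a b + g a b.

Definition total3 (k : fieldType) (D : lmodType k)
    (f1 f2 f3 : D -> D -> D -> D) (a b c : D) : D :=
  f1 a b c + f2 a b c + f3 a b c.

Section DendriformYamaguti.

Variables (k : fieldType) (D : lmodType k) (prec succ : D -> D -> D).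
Variables (br1 br2 br3 dbr1 dbr2 dbr3 : D -> D -> D -> D).

Local Notation "a '≺' b" := (prec a b) (at level 40, left associativity).
Local Notation "a '≻' b" := (succ a b) (at level 40, left associativity).
Local Notation "a '∗' b" := (total2 prec succ a b)
  (at level 40, left associativity).
Local Notation brT := (total3 br1 br2 br3).
Local Notation dbrT := (total3 dbr1 dbr2 dbr3).

Record is_dendriform_Yamaguti : Prop := {
  DY_prec : bilinear_map prec;
  DY_succ : bilinear_map succ;
  DY_br1 : trilinear_map br1;
  DY_br2 : trilinear_map br2;
  DY_br3 : trilinear_map br3;
  DY_dbr1 : trilinear_map dbr1;
  DY_dbr2 : trilinear_map dbr2;
  DY_dbr3 : trilinear_map dbr3;

  DY1_1 : forall a b c,
    (a ≺ b) ≺ c - a ≺ (b ∗ c) + br1 a b c - dbr1 a b c = 0;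
  DY1_2 : forall a b c,
    (a ≻ b) ≺ c - a ≻ (b ≺ c) + br2 a b c - dbr2 a b c = 0;
  DY1_3 : forall a b c,
    (a ∗ b) ≻ c - a ≻ (b ≻ c) + br3 a b c - dbr3 a b c = 0;

  DY2_1 : forall a b c d, br1 (a ≺ b) c d = br1 a (b ∗ c) d;
  DY2_2 : forall a b c d, br1 (a ≻ b) c d = br2 a (b ≺ c) d;
  DY2_3 : forall a b c d, br2 (a ∗ b) c d = br2 a (b ≻ c) d;
  DY2_4 : forall a b c d, br3 (a ∗ b) c d = br3 a (b ∗ c) d;

  DY3_1 : forall a b c d, br1 a b (c ∗ d) = br1 a b c ≺ d;
  DY3_2 : forall a b c d, br2 a b (c ∗ d) = br2 a b c ≺ d;
  DY3_3 : forall a b c d, br3 a b (c ≺ d) = br3 a b c ≺ d;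
  DY3_4 : forall a b c d, br3 a b (c ≻ d) = brT a b c ≻ d;

  DY4_1 : forall a b c d, dbr1 (a ≺ b) c d = a ≺ dbrT b c d;
  DY4_2 : forall a b c d, dbr1 (a ≻ b) c d = a ≻ dbr1 b c d;
  DY4_3 : forall a b c d, dbr2 (a ∗ b) c d = a ≻ dbr2 b c d;
  DY4_4 : forall a b c d, dbr3 (a ∗ b) c d = a ≻ dbr3 b c d;

  DY5_1 : forall a b c d, dbr1 a (b ∗ c) d = dbr1 a b (c ∗ d);
  DY5_2 : forall a b c d, dbr2 a (b ≺ c) d = dbr2 a b (c ∗ d);
  DY5_3 : forall a b c d, dbr2 a (b ≻ c) d = dbr3 a b (c ≺ d);
  DY5_4 : forall a b c d, dbr3 a (b ∗ c) d = dbr3 a b (c ≻ d);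

  DY6_1 : forall a b c d, a ≺ brT b c d = dbr1 a b c ≺ d;
  DY6_2 : forall a b c d, a ≻ br1 b c d = dbr2 a b c ≺ d;
  DY6_3 : forall a b c d, a ≻ br2 b c d = dbr3 a b c ≺ d;
  DY6_4 : forall a b c d, a ≻ br3 b c d = dbrT a b c ≻ d;

  DY7_1 : forall a b c d e,
    br1 (br1 a b c) d e = br1 a (dbrT b c d) e /\
    br1 a (dbrT b c d) e = br1 a b (brT c d e);
  DY7_2 : forall a b c d e,
    br1 (br2 a b c) d e = br2 a (dbr1 b c d) e /\
    br2 a (dbr1 b c d) e = br2 a b (brT c d e);
  DY7_3 : forall a b c d e,
    br1 (br3 a b c) d e = br2 a (dbr2 b c d) e /\
    br2 a (dbr2 b c d) e = br3 a b (br1 c d e);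
  DY7_4 : forall a b c d e,
    br2 (brT a b c) d e = br2 a (dbr3 b c d) e /\
    br2 a (dbr3 b c d) e = br3 a b (br2 c d e);
  DY7_5 : forall a b c d e,
    br3 (brT a b c) d e = br3 a (dbrT b c d) e /\
    br3 a (dbrT b c d) e = br3 a b (br3 c d e);

  DY8_1 : forall a b c d e, br1 a (brT b c d) e = br1 (dbr1 a b c) d e;
  DY8_2 : forall a b c d e, br2 a (br1 b c d) e = br1 (dbr2 a b c) d e;
  DY8_3 : forall a b c d e, br2 a (br2 b c d) e = br1 (dbr3 a b c) d e;
  DY8_4 : forall a b c d e, br2 a (br3 b c d) e = br2 (dbrT a b c) d e;
  DY8_5 : forall a b c d e, br3 a (brT b c d) e = br3 (dbrT a b c) d e;

  DY9_1 : forall a b c d e,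
    dbr1 (dbr1 a b c) d e = dbr1 a (brT b c d) e /\
    dbr1 a (brT b c d) e = dbr1 a b (dbrT c d e);
  DY9_2 : forall a b c d e,
    dbr1 (dbr2 a b c) d e = dbr2 a (br1 b c d) e /\
    dbr2 a (br1 b c d) e = dbr2 a b (dbrT c d e);
  DY9_3 : forall a b c d e,
    dbr1 (dbr3 a b c) d e = dbr2 a (br2 b c d) e /\
    dbr2 a (br2 b c d) e = dbr3 a b (dbr1 c d e);
  DY9_4 : forall a b c d e,
    dbr2 (dbrT a b c) d e = dbr2 a (br3 b c d) e /\
    dbr2 a (br3 b c d) e = dbr3 a b (dbr2 c d e);
  DY9_5 : forall a b c d e,
    dbr3 (dbrT a b c) d e = dbr3 a (brT b c d) e /\
    dbr3 a (brT b c d) e = dbr3 a b (dbr3 c d e);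

  DY10_1 : forall a b c d e, dbr1 a (dbrT b c d) e = dbr1 a b (brT c d e);
  DY10_2 : forall a b c d e, dbr2 a (dbr1 b c d) e = dbr2 a b (brT c d e);
  DY10_3 : forall a b c d e, dbr2 a (dbr2 b c d) e = dbr3 a b (br1 c d e);
  DY10_4 : forall a b c d e, dbr2 a (dbr3 b c d) e = dbr3 a b (br2 c d e);
  DY10_5 : forall a b c d e, dbr3 a (dbrT b c d) e = dbr3 a b (br3 c d e);

  DY11_1 : forall a b c d e, br1 a b (dbrT c d e) = dbr1 (br1 a b c) d e;
  DY11_2 : forall a b c d e, br2 a b (dbrT c d e) = dbr1 (br2 a b c) d e;
  DY11_3 : forall a b c d e, br3 a b (dbr1 c d e) = dbr1 (br3 a b c) d e;
  DY11_4 : forall a b c d e, br3 a b (dbr2 c d e) = dbr2 (brT a b c) d e;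
  DY11_5 : forall a b c d e, br3 a b (dbr3 c d e) = dbr3 (brT a b c) d e
}.

End DendriformYamaguti.

(* Main.v *)
(* The identities of a dendriform-Yamaguti algebra mark one argument of each
   identity (AYn).  Applying R to every unmarked variable, the Rota-Baxter
   identities collapse each [R (total ...)] into an operation of A, and what
   remains is (AYn) with the marked variable in M. *)

Require Import Defs.
From mathcomp Require Import all_boot all_order all_algebra.

Set Implicit Arguments.
Unset Strict Implicit.
Unset Printing Implicit Defensive.

Import GRing.Theory.
Local Open Scope ring_scope.

Section Precomposition.

Variables (k : fieldType) (M A : lmodType k) (R : {linear M -> A}).

(** The operations on [M] are structure maps precomposed with [R]; the lemmas of this section give
    their multilinearity. *)
Lemma bilinear_map_compl (f : A -> M -> M) :
  bilinear_map f -> bilinear_map (fun u v => f (R u) v).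
Proof.
(* [?linearP] acts only in a slot fed through [R]; the tuple then selects the linearity of [f] in
   that slot. *)
by case=> lf1 lf2; split=> v c x y /=; rewrite ?linearP (lf1, lf2).
Qed.

Lemma bilinear_map_compr (f : M -> A -> M) :
  bilinear_map f -> bilinear_map (fun u v => f u (R v)).
Proof.
by case=> lf1 lf2; split=> v c x y /=; rewrite ?linearP (lf1, lf2).
Qed.

Lemma trilinear_map_comp23 (f : M -> A -> A -> M) :
  trilinear_map f -> trilinear_map (fun u v w => f u (R v) (R w)).
Proof.
by case=> lf1 lf2 lf3; split=> u v c x y; rewrite ?linearP (lf1, lf2, lf3).
Qed.

Lemma trilinear_map_comp13 (f : A -> M -> A -> M) :
  trilinear_map f -> trilinear_map (fun u v w => f (R u) v (R w)).
Proof.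
by case=> lf1 lf2 lf3; split=> u v c x y; rewrite ?linearP (lf1, lf2, lf3).
Qed.

Lemma trilinear_map_comp12 (f : A -> A -> M -> M) :
  trilinear_map f -> trilinear_map (fun u v w => f (R u) (R v) w).
Proof.
by case=> lf1 lf2 lf3; split=> u v c x y; rewrite ?linearP (lf1, lf2, lf3).
Qed.

End Precomposition.

Theorem theorem6p14 (k : fieldType) (char0 : [pchar k] =i pred0)
    (A : lmodType k) (mul : A -> A -> A) (br dbr : A -> A -> A -> A)
    (hA : is_assoc_Yamaguti mul br dbr)
    (M : lmodType k)
    (mul1 : M -> A -> M) (mul2 : A -> M -> M)
    (br1 : M -> A -> A -> M) (br2 : A -> M -> A -> M) (br3 : A -> A -> M -> M)
    (dbr1 : M -> A -> A -> M) (dbr2 : A -> M -> A -> M)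
    (dbr3 : A -> A -> M -> M)
    (hM : is_representation mul br dbr mul1 mul2 br1 br2 br3 dbr1 dbr2 dbr3)
    (R : {linear M -> A})
    (hR : is_relative_Rota_Baxter mul br dbr mul1 mul2
            br1 br2 br3 dbr1 dbr2 dbr3 R) :
  is_dendriform_Yamaguti
    (fun u v => mul1 u (R v))
    (fun u v => mul2 (R u) v)
    (fun u v w => br1 u (R v) (R w))
    (fun u v w => br2 (R u) v (R w))
    (fun u v w => br3 (R u) (R v) w)
    (fun u v w => dbr1 u (R v) (R w))
    (fun u v w => dbr2 (R u) v (R w))
    (fun u v w => dbr3 (R u) (R v) w).
Proof.
(* The Rota-Baxter identities are reversed and their summands put in the order of [total2] and
   [total3], so that they rewrite unfolded totals. *)
have Rmul u v : R (mul1 u (R v) + mul2 (R u) v) = mul (R u) (R v).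
  by rewrite (RB_mul hR) addrC.
have Rbr u v w :
    R (br1 u (R v) (R w) + br2 (R u) v (R w) + br3 (R u) (R v) w) =
    br (R u) (R v) (R w).
  by rewrite (RB_br hR) addrC [br1 _ _ _ + _]addrC addrA.
have Rdbr u v w :
    R (dbr1 u (R v) (R w) + dbr2 (R u) v (R w) + dbr3 (R u) (R v) w) =
    dbr (R u) (R v) (R w).
  by rewrite (RB_dbr hR) addrC [dbr1 _ _ _ + _]addrC addrA.
case: hM => *; split.
- exact: bilinear_map_compr.
- exact: bilinear_map_compl.
- exact: trilinear_map_comp23.
- exact: trilinear_map_comp13.
- exact: trilinear_map_comp12.
- exact: trilinear_map_comp23.
- exact: trilinear_map_comp13.
- exact: trilinear_map_comp12.
(* The goal [DYn_i] is now [repAYn_i] evaluated at [R]-images in every slot but the i-th, and [auto]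
   finds that identity among the hypotheses. *)
all: by move=> *; rewrite /total2 /total3 ?Rmul ?Rbr ?Rdbr; auto.
Qed.
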